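(* Assume the Continuum Hypothesis ($2^{\aleph_0}=\aleph_1$). Then for every $n<\omega$, $$\omega_3\rightarrow(\omega_1\times n)^2_2 .$$
   Context: Work in ZFC. $\omega_1\times n$ is the ordinal product ($n$ consecutive copies of $\omega_1$). For ordinals $\beta,\alpha$, $\beta\rightarrow(\alpha)^2_2$ means: for every $c:[\beta]^2\to\{0,1\}$ (where $[\beta]^2$ is the set of two-element subsets of $\beta$) there is $A\subseteq\beta$ of order type $\alpha$ such that $c$ is constant on $[A]^2$. *)

(* Defs.v *)
From mathcomp Require Import all_boot.
From mathcomp Require Import boolp classical_sets functions wochoice cardinality.

Set Implicit Arguments.
Unset Strict Implicit.
Unset Printing Implicit Defensive.

Local Open Scope classical_set_scope.
Local Open Scope card_scope.

(* Ordinals are represented by well-ordered types, ord_le being the non-strict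
   order; the notions below are invariant under order isomorphism. *)
Record ordinal_type := OrdinalType {
  ord_sort :> Type;
  ord_le : rel ord_sort;
  ord_wo : well_order ord_le
}.
Arguments ord_wo : clear implicits.

Definition initial_segment (b : ordinal_type) (x : b) : set b :=
  [set y | ord_le y x /\ y <> x].

(* b is the least ordinal that does not inject into a *)
Definition is_hartogs (a b : ordinal_type) : Prop :=
  ~~ ([set: b] #<= [set: a]) /\
  forall x : b, initial_segment x #<= [set: a].

Section WellOrder.
Variables (T : Type) (R : rel T).

Lemma well_order_refl : well_order R -> reflexive R.
Proof.
move=> Rwo x.
by apply: (@wo_chain_reflexive {classic T} R predT (fun A _ => Rwo A)).
Qed.

Lemma well_order_anti : well_order R -> antisymmetric R.
Proof.
move=> Rwo x y.
exact: (@wo_chain_antisymmetric {classic T} R predT (fun A _ => Rwo A)).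
Qed.

Lemma well_order_total : well_order R -> total R.
Proof.
by move=> Rwo x y; apply: (@wo_chainW {classic T} R predT (fun A _ => Rwo A)).
Qed.

Lemma well_order_min (P : set T) : well_order R -> P !=set0 ->
  exists2 x, P x & forall y, P y -> R x y.
Proof.
move=> Rwo [x Px]; have [|z [[zP zmin] _]] := Rwo (fun x => `[< P x >]).
  by exists x; apply/asboolP.
exists z; first exact/asboolP.
by move=> y Py; apply: zmin; apply/asboolP.
Qed.

Lemma well_orderP : antisymmetric R ->
  (forall P : set T, P !=set0 -> exists2 x, P x & forall y, P y -> R x y) ->
  well_order R.
Proof.
move=> Ranti Rmin; apply: antisymmetric_well_order => // A [x Ax].
have [|z Az zmin] := Rmin (fun x => x \in A); first by exists x.
by exists z; split=> // y; apply: zmin.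
Qed.

End WellOrder.

Lemma wo_relpre (T U : Type) (R : rel U) (f : T -> U) :
  injective f -> well_order R -> well_order (relpre f R).
Proof.
move=> finj Rwo; apply: well_orderP => [x y /= /(well_order_anti Rwo)/finj //|].
move=> P [x Px]; have [|_ [z Pz <-] zmin] := well_order_min (P := f @` P) Rwo.
  by exists (f x), x.
by exists z => // y Py; apply: zmin; exists y.
Qed.

Lemma leq_well_order : well_order leq.
Proof.
apply: well_orderP => [|P [x Px]]; first exact: anti_leq.
have [z /asboolP Pz zmin] :=
  ex_minnP (ex_intro (fun n => `[< P n >]) x (asboolT Px)).
by exists z => // y Py; apply: zmin; apply/asboolP.
Qed.

Definition ord_nat : ordinal_type := OrdinalType leq_well_order.

Definition ord_fin (n : nat) : ordinal_type :=
  OrdinalType (wo_relpre (@ord_inj n) leq_well_order).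

Section Product.
Variables a b : ordinal_type.

Definition prod_le : rel (b * a) := fun p q =>
  ord_le p.1 q.1 && (ord_le q.1 p.1 ==> ord_le p.2 q.2).

Lemma prod_well_order : well_order prod_le.
Proof.
have [wa wb] := (ord_wo a, ord_wo b).
apply: well_orderP => [[i x] [j y]|P [p Pp]]; rewrite /prod_le /=.
  case/andP => /andP[ij xy] /andP[ji yx]; move: xy yx; rewrite ij ji /= => xy yx.
  congr pair; first by apply: (well_order_anti wb); rewrite ij.
  by apply: (well_order_anti wa); rewrite xy.
have [|_ [[i x0] Pi /= <-] imin] := well_order_min (P := fst @` P) wb.
  by exists p.1, p.
have [|x Px xmin] := well_order_min (P := [set x | P (i, x)]) wa.
  by exists x0.
exists (i, x) => // -[j y] Py /=; rewrite imin /=; last by exists (j, y).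
apply/implyP => ji; apply: xmin; suff <- : j = i by [].
by apply: (well_order_anti wb); rewrite ji imin //; exists (j, y).
Qed.

(* The ordinal product a * b, that is b consecutive copies of a: pairs are
   compared lexicographically, the index in b of the copy coming first. *)
Definition ord_mul : ordinal_type := OrdinalType prod_well_order.

End Product.

Lemma hartogs_exists (a : ordinal_type) : exists b, is_hartogs a b.
Proof.
have [R0 R0wo] := well_ordering_principle {classic set a}.
pose R : rel (set a) := R0; have Rwo : well_order R := R0wo.
have notinj : ~ exists f : set a -> a, injective f.
  case=> f finj; pose D := [set x | exists2 X, f X = x & ~ X x].
  have [DfD|nDfD] := pselect (D (f D)).
    by case: (DfD) => X /finj -> /(_ DfD).
  by apply: (nDfD); exists D.
have [[x0 x0P]|small] := pselect (exists x : set a,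
    ~~ ([set y | R y x /\ y <> x] #<= [set: a])).
  have [|x /= xP xmin] := well_order_min
      (P := fun x => ~~ ([set y | R y x /\ y <> x] #<= [set: a])) Rwo.
    by exists x0.
  pose S := {y : set a | R y x /\ y <> x}.
  have vinj : injective (@proj1_sig _ _ : S -> set a).
    by move=> [u pu] [v pv] /= uv; apply: eq_exist.
  exists (OrdinalType (wo_relpre vinj Rwo)); split=> /=.
    apply: contra xP => Sa; apply: card_le_trans Sa; apply/card_leP/injfunPex.
    exists (fun s : [set y | R y x /\ y <> x] =>
      SigSub (mem_set (I : [set: S] (exist _ (val s) (set_mem (valP s)))))) => //.
    by move=> s t _ _ [] /val_inj.
  move=> [y [yx nyx]].
  have ya : [set z | R z y /\ z <> y] #<= [set: a].
    apply: contrapT => /negP /xmin xy.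
    by apply: nyx; apply: (well_order_anti Rwo); rewrite yx xy.
  apply: card_le_trans ya; apply/card_leP/injfunPex.
  have memP (s : initial_segment (b := OrdinalType (wo_relpre vinj Rwo))
      (exist _ y (conj yx nyx))) :
      [set z | R z y /\ z <> y] (proj1_sig (val s)).
    have [/= sy nsy] := set_mem (valP s); split=> // sE; apply: nsy.
    exact: (vinj).
  exists (fun s => SigSub (mem_set (memP s))) => //.
  by move=> s t _ _ [] H; apply: val_inj; apply: (vinj).
exists (OrdinalType Rwo); split=> /=.
  apply/negP => /card_leP[f]; apply: notinj.
  exists (fun X => val (f (SigSub (mem_set (I : [set: set a] X))))) => X Y.
  by move=> /val_inj fXY; have [] := inj (mem_set I) (mem_set I) fXY.
by move=> x; apply: contrapT => /negP nx; apply: small; exists x.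
Qed.

(* The initial ordinal omega_k. The representative chosen at each successor is
   determined up to order isomorphism by is_hartogs. *)
Fixpoint omega (k : nat) : ordinal_type :=
  if k is k'.+1 then sval (cid (hartogs_exists (omega k'))) else ord_nat.

Lemma omegaS (k : nat) : is_hartogs (omega k) (omega k.+1).
Proof. exact: svalP (cid (hartogs_exists (omega k))). Qed.

(* 2 ^ aleph_0 = aleph_1 *)
Definition continuum_hypothesis : Prop := [set: set nat] #= [set: omega 1].

(* [A]^2 *)
Definition doubletons (T : Type) (A : set T) : set (set T) :=
  [set s | exists x y, [/\ A x, A y, x <> y & s = [set x; y]]].

Definition has_order_type (b : ordinal_type) (A : set b) (a : ordinal_type) :=
  exists2 f : a -> b, set_bij [set: a] A f & {mono f : x y / ord_le x y}.

(* b -> (a)^2_2 *)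
Definition arrow (b a : ordinal_type) : Prop :=
  forall c : doubletons [set: b] -> bool,
    exists A : set b, has_order_type A a /\
      exists i : bool, forall s, doubletons A (val s) -> c s = i.

(* Main.v *)
(* Write "small" for: of size at most 2^aleph_0 = aleph_1, and "large" otherwise.
   Cut omega_3 into consecutive large blocks Z_0 < Z_1 < ... whose proper initial
   segments are small.

   Fix a small N reflecting the large realisable countable types, as a submodel
   closed under countable sequences would. A point a outside N generates a
   countably complete filter on N by its countable types. If points a_1, ..., a_n
   in different blocks and sets X_k positive for the filter of a_k are such that
   every X_k has colour b with every a_l, then uncountable A_k in X_k with
   homogeneous union are found by a maximality argument, as each new element only
   has to respect countably many earlier ones.

   To find such points, call X heavy if it is positive for a large set of points
   of its block. Given a heavy X, a block Z_v is decided by X if X has constant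
   colour with a large part of Z_v; if no heavy part of X decides Z_v, then for
   almost all a in Z_v both colours with a occur on heavy parts of X. A heavy set
   contains uncountable homogeneous sets of both colours, so if it decides many
   later blocks one may pass to the common neighbourhoods of such a set and argue
   by induction. Otherwise the decided blocks are dropped, a point is selected, and
   the only constraint left is the colour of the later sets with the earlier
   points, which is made uniform as in the proof of the finite Ramsey theorem. The
   homogeneity of both colours may fail only if an uncountable homogeneous set has
   large common neighbourhood in its own block; if this happens hereditarily, a
   homogeneous set of type omega_1 * n is built inside that block. *)
From mathcomp Require Import all_boot.
From mathcomp Require Import boolp classical_sets functions wochoice cardinality.
From mathcomp Require Import zify.
Require Import Defs.

Set Implicit Arguments.
Unset Strict Implicit.
Unset Printing Implicit Defensive.

Local Open Scope classical_set_scope.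
Local Open Scope card_scope.

(* By CH, having at most the cardinality of the continuum means having at most
   aleph_1 elements; "large" below means "not small". *)
Definition small (T : Type) (A : set T) : Prop := A #<= [set: set nat].

(** * Closure properties of small sets *)

Lemma smallP (T : Type) (A : set T) :
  small A <-> exists f : T -> set nat, {in A &, injective f}.
Proof. exact: iff_sym (rwP pcard_injP). Qed.

Lemma countable_small (T : Type) (A : set T) : countable A -> small A.
Proof.
move=> /countable_injP[f finj]; apply/smallP; exists (fun x => [set f x]).
by move=> x y Ax Ay /seteqP[/(_ _ erefl) fxy _]; apply: finj.
Qed.

Lemma countable_setU (T : Type) (A B : set T) :
  countable A -> countable B -> countable (A `|` B).
Proof.
move=> cA cB; rewrite -bigcup2inE.
by apply: bigcup_countable => // -[|[|n]].
Qed.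

Section Small.
Context {T : Type}.
Implicit Types A B : set T.

Lemma small_sub A B : A `<=` B -> small B -> small A.
Proof. by move=> AB; apply: card_le_trans (subset_card_le AB). Qed.

(** A point is coded by interleaving the code of one chosen index [i] (odd places) with its own code
    inside [F i] (even places). *)
Lemma small_bigcup (I : Type) (D : set I) (F : I -> set T) :
  small D -> (forall i, D i -> small (F i)) -> small (\bigcup_(i in D) F i).
Proof.
move=> /smallP[d dinj] smallF.
have /choice[f finj] : forall i, exists g : T -> set nat,
    D i -> {in F i &, injective g}.
  move=> i; have [Di|nDi] := pselect (D i); last by exists (fun=> set0).
  by have /smallP[g] := smallF i Di; exists g.
have /choice[g gP] : forall x, exists o, (\bigcup_(i in D) F i) x ->
    exists2 i, o = Some i & D i /\ F i x.
  move=> x; have [[i Di Fx]|nx] := pselect ((\bigcup_(i in D) F i) x).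
    by exists (Some i); exists i.
  by exists None.
apply/smallP; exists (fun x => if g x is Some i then
  [set n | if odd n then d i n./2 else f i x n./2] else set0) => x y.
move=> /set_mem /gP[i -> [Di Fx]] /set_mem /gP[j -> [Dj Fy]] /= E.
have dE : d i = d j.
  rewrite predeqE => n.
  have := congr1 (fun S : set nat => S n.*2.+1) E; rewrite /= odd_double /= uphalf_double.
  by move=> ->.
have ij : i = j by apply: dinj => //; apply/mem_set.
subst j; apply: (finj i Di); [exact/mem_set|exact/mem_set|].
rewrite predeqE => n.
by have := congr1 (fun S : set nat => S n.*2) E; rewrite /= odd_double /= doubleK => ->.
Qed.

Lemma small_setU A B : small A -> small B -> small (A `|` B).
Proof.
move=> sA sB; rewrite -bigcup2inE.
by apply: small_bigcup => [|[|[|n]] //]; apply: countable_small.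
Qed.

Lemma small_pigeonhole (I : Type) (D : set I) (A : set T) (F : I -> set T) :
  small D -> ~ small A -> (forall x, A x -> exists2 i, D i & F i x) ->
  exists2 i, D i & ~ small (A `&` F i).
Proof.
move=> sD nsA cover; apply: contrapT => no; apply: nsA.
apply: (@small_sub _ (\bigcup_(i in D) (A `&` F i))) => [x Ax|].
  by have [i Di Fx] := cover x Ax; exists i.
by apply: small_bigcup => // i Di; apply: contrapT => ns; apply: no; exists i.
Qed.

Lemma not_small_nonempty A : ~ small A -> A !=set0.
Proof.
move=> nsA; apply: contrapT => /set0P/negP/negPn/eqP A0; apply: nsA.
by rewrite A0; apply: card_ge0.
Qed.

Lemma not_smallD A B : ~ small A -> small B -> ~ small (A `\` B).
Proof.
move=> nsA sB sAB; apply: nsA; apply: small_sub (small_setU sAB sB) => x Ax.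
by have [Bx|nBx] := pselect (B x); [right|left].
Qed.

End Small.

Lemma small_image (T U : Type) (A : set T) (f : T -> U) :
  small A -> small (f @` A).
Proof. by apply: card_le_trans; apply: card_image_le. Qed.

(** The continuum to the power aleph_0 is the continuum: a sequence of subsets of [nat] is a single
    subset of a countable type. [Some m] tags the members of the [n]-th set, [None] its bit. *)
Lemma small_seq_valued (T : Type) (A : set T) :
  small A -> small [set k : (nat -> T) * (nat -> bool) | forall n, A (k.1 n)].
Proof.
move=> /smallP[f finj]; apply/smallP.
exists (fun k => [set p | match @unpickle (nat * option nat)%type p with
  | Some (n, Some m) => f (k.1 n) m
  | Some (n, None) => is_true (k.2 n)
  | None => False end]).
move=> [s b] [s' b'] /set_mem /= As /set_mem /= As' E.
congr pair; apply/funext => n.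
  apply: finj; rewrite ?inE //; rewrite predeqE => m.
  have := congr1 (fun S : set nat => S (pickle (n, Some m))) E.
  by rewrite /= pickleK => ->.
have := congr1 (fun S : set nat => S (pickle (n, @None nat))) E.
by rewrite /= pickleK => bE; apply/idP/idP; rewrite bE.
Qed.

(** * Types over a small set *)

Section Types.
Variables (T : Type) (c : T -> T -> bool) (N : set T).
Hypothesis cC : forall x y, c x y = c y x.

(* A key prescribes the colours between a point and countably many elements of
   N; its cell consists of the points outside that countable set realising it. *)
Definition key : Type := ((nat -> T) * (nat -> bool))%type.

Definition keys : set key := [set k | forall n, N (k.1 n)].

Definition cell (k : key) : set T :=
  [set y | forall n, c (k.1 n) y = k.2 n /\ y <> k.1 n].

(* N plays the part of an elementary submodel closed under countable sequences. *)
Definition closed_for (Z : set T) : Prop :=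
  forall k, keys k -> ~ small (Z `&` cell k) -> N `&` Z `&` cell k !=set0.

Definition homog (b : bool) (A : set T) : Prop :=
  forall x y, A x -> A y -> x <> y -> c x y = b.

Definition fiber (X : set T) (a : T) (b : bool) : set T :=
  [set x | X x /\ c x a = b].

Definition decided (X V : set T) (b : bool) : set T :=
  [set a | V a /\ forall x, X x -> c x a = b].

(* The cells of the keys realised by a generate a countably complete filter, by
   cell_merge and the use of sequences as keys; X has to be positive for it. *)
Definition accum (a : T) (X : set T) : Prop :=
  ~ N a /\ forall k, keys k -> cell k a -> X `&` cell k !=set0.

Definition heavy (Z X : set T) : Prop := ~ small [set a | Z a /\ accum a X].

(* Unlike accum a X, this survives the restriction of X to one of the colours
   with almost every further point (heavy_at_fiber_almost). *)
Definition heavy_at (Z : set T) (a : T) (X : set T) : Prop :=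
  ~ N a /\ forall k, keys k -> cell k a -> heavy Z (X `&` cell k).

Definition undecided (Z X V : set T) : Prop :=
  forall X' b, X' `<=` X -> heavy Z X' -> small (decided X' V b).

Lemma cell_merge k k' : keys k -> keys k' ->
  exists2 k'', keys k'' & cell k'' = cell k `&` cell k'.
Proof.
move=> Nk Nk'.
exists (fun n => if odd n then k.1 n./2 else k'.1 n./2,
        fun n => if odd n then k.2 n./2 else k'.2 n./2).
  by move=> n /=; case: ifP.
apply/seteqP; split=> y /= yP; last first.
  by case: yP => yk yk' n /=; case: ifP => _; [apply: yk|apply: yk'].
split=> n.
  by have := yP n.*2.+1; rewrite /= odd_double /= uphalf_double.
by have := yP n.*2; rewrite /= odd_double /= doubleK.
Qed.

Lemma cell_of a (s : nat -> T) : ~ N a -> (forall n, N (s n)) ->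
  cell (s, fun n => c (s n) a) a.
Proof. by move=> Na sN n; split=> // aE; apply: Na; rewrite aE. Qed.

Lemma accum_sub a X X' : X `<=` X' -> accum a X -> accum a X'.
Proof.
by move=> XX' [Na aX]; split=> // k Nk /(aX k Nk)[x [/XX' X'x kx]]; exists x.
Qed.

Lemma accum_cell a X k : accum a X -> keys k -> cell k a ->
  accum a (X `&` cell k).
Proof.
move=> [Na aX] Nk ka; split=> // k' Nk' k'a.
have [k'' Nk'' E] := cell_merge Nk Nk'.
by rewrite -setIA -E; apply: aX => //; rewrite E.
Qed.

Lemma accum_split a X B : accum a X -> accum a (X `&` B) \/ accum a (X `\` B).
Proof.
move=> [Na aX]; apply: contrapT => /not_orP[nB nD].
have [k [Nk [ka kX]]] : exists k, keys k /\ cell k a /\ ~ (X `&` B `&` cell k !=set0).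
  apply: contrapT => no; apply: nB; split=> // k Nk ka.
  by apply: contrapT => kX; apply: no; exists k.
have [l [Nl [la lX]]] : exists k, keys k /\ cell k a /\ ~ ((X `\` B) `&` cell k !=set0).
  apply: contrapT => no; apply: nD; split=> // l Nl la.
  by apply: contrapT => lX; apply: no; exists l.
have [m Nm E] := cell_merge Nk Nl.
have [|x [Xx]] := aX m Nm; first by rewrite E.
rewrite E => -[kx lx]; have [Bx|nBx] := pselect (B x).
  by apply: kX; exists x.
by apply: lX; exists x.
Qed.

Lemma accum_countable a X C : N !=set0 -> accum a X -> C `<=` N -> countable C ->
  exists2 x, X x & forall y, C y -> c y x = c y a /\ x <> y.
Proof.
move=> [n0 Nn0] [Na aX] CN Ccount.
have [s sN sC] : exists2 s : nat -> T, forall n, N (s n) & C `<=` range s.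
  have /countable_injP[f finj] := Ccount.
  have /choice[s sP] : forall n, exists x, N x /\
      forall y, C y -> f y = n -> x = y.
    (* [n0] fills the places that enumerate nothing, since a key must stay inside [N]. *)
    move=> n; have [[y Cy fy]|no] := pselect (exists2 y, C y & f y = n).
      exists y; split=> [|z Cz fz]; first exact: CN.
      by apply: finj; rewrite ?inE // fy fz.
    by exists n0; split=> // y Cy fy; case: no; exists y.
  exists s => [n|y Cy]; first by case: (sP n).
  by exists (f y) => //; have [_ sE] := sP (f y); apply: sE.
have [|x [Xx xk]] := aX (s, fun n => c (s n) a) sN; first exact: cell_of.
by exists x => // y /sC[n _ <-]; apply: xk.
Qed.

(** * Heavy sets and the behaviour of almost all points *)

Hypotheses (N_small : small N) (N_nonempty : N !=set0).

Lemma keys_small : small keys.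
Proof. exact: small_seq_valued. Qed.

Lemma heavy_sub Z X X' : X `<=` X' -> heavy Z X -> heavy Z X'.
Proof.
move=> XX' + sX'; apply; apply: small_sub sX' => a [Za aX].
by split=> //; apply: accum_sub aX.
Qed.

Lemma heavy_split Z X B : heavy Z X -> heavy Z (X `&` B) \/ heavy Z (X `\` B).
Proof.
move=> hX; apply: contrapT => /not_orP[/contrapT sI /contrapT sD]; apply: hX.
apply: small_sub (small_setU sI sD) => a [Za aX].
by have [?|?] := accum_split B aX; [left|right].
Qed.

Lemma heavy_fiber Z X a : heavy Z X -> exists b, heavy Z (fiber X a b).
Proof.
move=> /(heavy_split [set x | c x a = true])[hX|hX].
  by exists true; apply: heavy_sub hX => x [].
exists false; apply: heavy_sub hX => x [Xx nxa]; split=> //.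
by move: nxa => /=; case: (c x a).
Qed.

Lemma not_small_keyed (A : set T) (F : key -> set T) : ~ small A ->
  (forall x, A x -> exists2 k, keys k & F k x) ->
  exists2 k, keys k & ~ small (A `&` F k).
Proof. by apply: small_pigeonhole; apply: keys_small. Qed.

Lemma accum_nonempty a X : accum a X -> X !=set0.
Proof.
move=> aX; have [x Xx _] := accum_countable N_nonempty aX (@sub0set _ N)
  (countable0 _).
by exists x.
Qed.

Lemma heavy_at_accum Z a X : heavy_at Z a X -> accum a X.
Proof.
move=> [Na aX]; split=> // k Nk ka.
by have /not_small_nonempty[b [_ /accum_nonempty]] := aX k Nk ka.
Qed.

(** There are few keys, so few points lie in [N] or in a cell whose trace on [Z] is small.
    Closedness makes every other point of [Z] an accumulation point. *)
Lemma heavy_closed Z : ~ small Z -> closed_for Z -> heavy Z (N `&` Z).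
Proof.
move=> nsZ Zclosed.
pose bad := \bigcup_(k in [set k | keys k /\ small (Z `&` cell k)]) (Z `&` cell k).
have sbad : small bad.
  apply: small_bigcup => [|k [] //].
  by apply: small_sub keys_small => k [].
have nsG := not_smallD nsZ (small_setU N_small sbad).
move=> sZ; apply: nsG; apply: small_sub sZ => a [Za nbad]; split=> //.
split=> [Na|k Nk ka]; first by apply: nbad; left.
apply: Zclosed => // sk; apply: nbad; right.
by exists k.
Qed.

(** Otherwise a single key witnesses the failure at a large set of accumulation points; these same
    points make the trace of [X] on its cell heavy. *)
Lemma heavy_heavy_at Z X : heavy Z X -> ~ small [set a | Z a /\ heavy_at Z a X].
Proof.
move=> hX sX; have := not_smallD hX sX; set A := _ `\` _ => nsA.
have [k Nk] : exists2 k, keys k & ~ small (A `&`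
    [set a | cell k a /\ ~ heavy Z (X `&` cell k)]).
  apply: not_small_keyed => // a [[Za [Na aX]] nat].
  apply: contrapT => no; apply: nat; split=> //; split=> // k Nk ka.
  by apply: contrapT => nh; apply: no; exists k.
move=> ns; have [a [_ [_ nh]]] := not_small_nonempty ns; apply: nh => sh.
apply: ns; apply: small_sub sh => b [[[Zb bX] _] [kb _]]; split=> //.
exact: accum_cell.
Qed.

(** Two pigeonholes over keys. If the fiber of [a] is not heavy, some heavy trace of [X] on a cell
    has colour [~~ b] with [a]; one key then serves a large set of [a], against [undecided]. *)
Lemma heavy_fiber_almost Z X V b : heavy Z X -> undecided Z X V ->
  small [set a | V a /\ ~ heavy Z (fiber X a b)].
Proof.
move=> hX undec; apply: contrapT => nsD.
pose F (k : key) := [set a : T | heavy Z (X `&` cell k) /\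
  forall x, (X `&` cell k) x -> c x a = ~~ b].
have [|k Nk] := not_small_keyed (F := F) nsD.
  move=> a [Va /contrapT sW]; have := not_smallD hX sW; set A := _ `\` _ => nsA.
  have [|k Nk nsk] := not_small_keyed (F := fun k => [set a' | cell k a' /\
      forall x, (X `&` cell k) x -> c x a = ~~ b]) nsA.
    move=> a' [[Za' [Na' a'X]] nW].
    apply: contrapT => no; apply: nW; split=> //; split=> // k Nk ka'.
    apply: contrapT => k0; apply: no; exists k => //; split=> // x [Xx kx].
    case: (c x a =P b) => [xa|/eqP]; last by case: (c x a) (b) => -[].
    by case: k0; exists x.
  exists k => //; have [a0 [_ [_ all]]] := not_small_nonempty nsk; split=> // sk.
  apply: nsk; apply: small_sub sk => a' [[[Za' a'X] _] [ka' _]]; split=> //.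
  exact: accum_cell.
move=> ns; have [a0 [_ [hk _]]] := not_small_nonempty ns; apply: ns.
apply: small_sub (undec (X `&` cell k) (~~ b) _ hk) => [a [[Va _] [_ all]]|x []//].
by split.
Qed.

Lemma undecided_sub Z X X' V : X' `<=` X -> undecided Z X V -> undecided Z X' V.
Proof. by move=> X'X u X'' b X''X'; apply: u; apply: subset_trans X'X. Qed.

Lemma heavy_at_fiber_almost Z X V a b : heavy_at Z a X -> undecided Z X V ->
  small [set a' | V a' /\ ~ heavy_at Z a (fiber X a' b)].
Proof.
move=> [Na aX] undec; apply: contrapT => ns.
have [|k Nk nsk] := not_small_keyed (F := fun k => [set a' | cell k a /\
    ~ heavy Z (fiber (X `&` cell k) a' b)]) ns.
  move=> a' [Va' nat]; apply: contrapT => no; apply: nat; split=> // k Nk ka.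
  apply: contrapT => nh; apply: no; exists k => //; split=> // h; apply: nh.
  by apply: heavy_sub h => x [[]].
have [a0 [_ [ka _]]] := not_small_nonempty nsk; apply: nsk.
have undeck : undecided Z (X `&` cell k) V by apply: undecided_sub undec => x [].
by apply: small_sub (heavy_fiber_almost b (aX k Nk ka) undeck) => a' [[Va' _] []].
Qed.

(** Here the point where [X] accumulates also gives the colour. Fixing the key by pigeonhole leaves
    a heavy trace that no longer depends on this point. *)
Lemma heavy_at_self_fiber_almost Z X b : undecided Z X Z ->
  small [set a | Z a /\ (heavy_at Z a X /\ ~ heavy_at Z a (fiber X a b))].
Proof.
move=> undec; apply: contrapT => ns.
have [|k Nk nsk] := not_small_keyed (F := fun k => [set a' |
    heavy Z (X `&` cell k) /\ ~ heavy Z (fiber (X `&` cell k) a' b)]) ns.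
  move=> a [Za [[Na aX] nat]]; apply: contrapT => no; apply: nat; split=> // k Nk ka.
  apply: contrapT => nh; apply: no; exists k => //; split; first exact: aX.
  by move=> h; apply: nh; apply: heavy_sub h => x [[]].
have [a0 [_ [hk _]]] := not_small_nonempty nsk; apply: nsk.
have undeck : undecided Z (X `&` cell k) Z by apply: undecided_sub undec => x [].
by apply: small_sub (heavy_fiber_almost b hk undeck) => a' [[Va' _] []].
Qed.

(** * Homogeneous sets near finitely many points *)

Section Rows.
Variables (o : seq nat) (b : bool) (X : nat -> set T) (al : nat -> T).
Hypothesis XN : forall k, k \in o -> X k `<=` N.
Hypothesis Xaccum : forall k, k \in o -> accum (al k) (X k).
Hypothesis Xal : forall k l x, k \in o -> l \in o -> X k x -> c x (al l) = b.

(** Entries are found one at a time: [accum] yields an element of [X k] imitating [al k] over [C]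
    and the entries already found. *)
Lemma row_exists (C : set T) (p : seq nat) : C `<=` N -> countable C ->
  (forall y k, C y -> k \in o -> c y (al k) = b) ->
  {subset p <= o} ->
  exists r : nat -> T,
    (forall k, k \in p -> X k (r k) /\ forall y, C y -> c y (r k) = b /\ r k <> y) /\
    forall k l, k \in p -> l \in p -> k <> l -> c (r k) (r l) = b /\ r k <> r l.
Proof.
move=> CN Cc Cal; elim: p => [_|k p IHp kpo].
  by have [n0 _] := N_nonempty; exists (fun=> n0).
have [|r [rX rr]] := IHp; first by move=> l lp; apply: kpo; rewrite inE lp orbT.
have ko : k \in o by apply: kpo; rewrite inE eqxx.
have po l : l \in p -> l \in o by move=> lp; apply: kpo; rewrite inE lp orbT.
have [kp|nkp] := boolP (k \in p).
  by exists r; split=> [l|l m]; rewrite !inE => /predU1P[->|lp];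
    do ?[move=> /predU1P[->|mp]]; auto.
pose C' := C `|` r @` [set l | l \in p].
have [||x Xx xP] := accum_countable N_nonempty (C := C') (Xaccum ko).
- move=> y [/CN//|[l lp <-]]; apply: (XN (po _ lp)); exact: (rX l lp).1.
- apply: countable_setU => //; apply: (sub_countable (card_image_le _ _)).
  exact: countableP.
exists (fun l => if l == k then x else r l); split=> [l|l m].
  rewrite inE => /predU1P[->|lp].
    rewrite eqxx; split=> // y Cy; have [|-> ?] := xP y; first by left.
    by split=> //; apply: Cal.
  by rewrite (_ : l == k = false); [exact: rX|apply: contraNF nkp => /eqP<-].
rewrite !inE => /predU1P[->|lp] /predU1P[->|mp] // nlm.
- have [|E ?] := xP (r m); first by right; exists m.
  rewrite eqxx (_ : m == k = false); last by apply: contraNF nkp => /eqP<-.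
  by split=> //; rewrite cC E; apply: (Xal (po _ mp) ko); case: (rX m mp).
- have [|E ?] := xP (r l); first by right; exists l.
  rewrite eqxx (_ : l == k = false); last by apply: contraNF nkp => /eqP<-.
  split; last exact: nesym.
  by rewrite E; apply: (Xal (po _ lp) ko); case: (rX l lp).
- rewrite (_ : l == k = false); last by apply: contraNF nkp => /eqP<-.
  rewrite (_ : m == k = false); last by apply: contraNF nkp => /eqP<-.
  exact: rr.
Qed.

(* A maximal family of pairwise compatible rows, one entry in each X k, cannot
   be countable. *)
Lemma uncountable_rows : exists A : nat -> set T,
  (forall k, k \in o -> A k `<=` X k /\ ~ countable (A k)) /\
  forall k l x y, k \in o -> l \in o -> A k x -> A l y -> x <> y -> c x y = b.
Proof.
(* The case [r = r'], [k <> l] covers two entries of the same row. *)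
pose P (F : set (nat -> T)) := forall r r' k l, F r -> F r' ->
  k \in o -> l \in o ->
  X k (r k) /\ (r <> r' \/ k <> l -> c (r k) (r' l) = b /\ r k <> r' l).
have [|F [PF Fmax]] := @Zorn_bigcup (nat -> T) P.
  move=> Q QP Qtot r r' k l [F QF Fr] [F' QF' F'r'].
  have [/(_ _ Fr) F'r|/(_ _ F'r') Fr'] := Qtot F F' QF QF'.
    by apply: (QP F').
  by apply: (QP F).
have PX r k : F r -> k \in o -> X k (r k).
  by move=> Fr ko; have [] := PF r r k k Fr Fr ko ko.
exists (fun k => (fun r => r k) @` F); split=> [k ko|].
  split=> [_ [r Fr <-]|Ac]; first exact: PX.
  (* Distinct rows have distinct [k]-th entries, so [F] injects into its [k]-th column. *)
  have Fc : countable F.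
    have /countable_injP[f finj] := Ac.
    apply/countable_injP; exists (fun r => f (r k)) => r r' /set_mem Fr /set_mem Fr'.
    move=> /finj E; apply: contrapT => ne.
    have [_ []] := PF r r' k k Fr Fr' ko ko; first by left.
    by move=> _; apply; apply: E; apply/mem_set; [exists r|exists r'].
  pose C := \bigcup_(r in F) (r @` [set l | l \in o]).
  have [| | | |r [rX rr]] := row_exists (C := C) (p := o) => //.
  - by move=> _ [r Fr [l lo <-]]; apply: (XN lo); apply: PX.
  - apply: bigcup_countable => // r Fr; apply: (sub_countable (card_image_le _ _)).
    exact: countableP.
  - by move=> _ l [r Fr [m mo <-]] lo; apply: (Xal mo lo); apply: PX.
  apply: (Fmax (F `|` [set r])).
    split=> [|sub]; first exact: subsetUl.
    have Fr : F r by apply: sub; right.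
    have [_ /(_ (r k))[]] := rX k ko; last by move=> _; apply.
    by exists r => //; exists k.
  have rC r' l m : F r' -> l \in o -> m \in o -> c (r' l) (r m) = b /\ r m <> r' l.
    move=> Fr' lo mo; have [_ /(_ (r' l))[|E ne]] := rX m mo; last by split.
    by exists r' => //; exists l.
  move=> r1 r2 l m [F1|->] [F2|->] lo mo.
  - exact: PF.
  - split=> [|_]; first exact: PX.
    by have [? ?] := rC _ _ _ F1 lo mo; split=> //; apply: nesym.
  - split=> [|_]; first by case: (rX l lo).
    by have [? ?] := rC _ _ _ F2 mo lo; split=> //; rewrite cC.
  - split=> [|[//|lm]]; first by case: (rX l lo).
    exact: rr.
move=> k l x y ko lo [r Fr <-] [r' Fr' <-] ne.
have [_ []//] := PF r r' k l Fr Fr' ko lo.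
by have [rr'|] := pselect (r = r'); [right=> kl; apply: ne; rewrite rr' kl|left].
Qed.

End Rows.

(* When Z is not sparse, an uncountable homogeneous subset has a large common
   neighbourhood inside Z, in which one can continue. *)
Definition sparse (Z : set T) : Prop := forall A b, A `<=` Z -> ~ countable A ->
  small A -> homog b A -> small (decided A Z b).

Lemma sub_sparse Z Z' : Z' `<=` Z -> sparse Z -> sparse Z'.
Proof.
move=> Z'Z Zs A b AZ' nA sA hA.
have AZ : A `<=` Z by apply: subset_trans Z'Z.
by apply: small_sub (Zs A b AZ nA sA hA) => a [/Z'Z].
Qed.

Lemma accum_homog a X b : X `<=` N -> accum a X -> (forall x, X x -> c x a = b) ->
  exists A, [/\ A `<=` X, ~ countable A, small A & homog b A].
Proof.
move=> XN aX Xb.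
have [||//|A [AX AA]] := @uncountable_rows [:: 0] b (fun=> X) (fun=> a) => //.
  by move=> k l x _ _; apply: Xb.
have [AX0 nA] := AX 0 (mem_head _ _); exists (A 0); split=> //.
  by apply: small_sub N_small; apply: subset_trans XN.
by move=> x y Ax Ay; apply: (AA 0 0); rewrite ?inE.
Qed.

(** If the fiber of colour [b] still accumulates at some point, [accum_homog] applies. Otherwise the
    trace of [X] on one cell has colour [~~ b] with a large set of points, and an uncountable
    homogeneous subset of that colour contradicts sparseness. *)
Lemma heavy_homog Z X b : sparse Z -> X `<=` N `&` Z -> heavy Z X ->
  exists A, [/\ A `<=` X, ~ countable A, small A & homog b A].
Proof.
move=> Zs XNZ hX; apply: contrapT => no.
have XN : X `<=` N by move=> x /XNZ[].
have [|k Nk ns] := not_small_keyed (F := fun k => [set a | cell k a /\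
    forall x, (X `&` cell k) x -> c x a = ~~ b]) hX.
  move=> a [Za aX]; apply: contrapT => nok; apply: no.
  have XbX : fiber X a b `<=` X by move=> x [].
  have [||x []//|A [AX ? ? ?]] := @accum_homog a (fiber X a b) b.
  - exact: subset_trans XN.
  - case: aX => Na aX; split=> // k Nk ka; apply: contrapT => nk; apply: nok.
    exists k => //; split=> // x [Xx kx].
    case: (c x a =P b) => [xa|]; last by case: (c x a) (b) => -[].
    by case: nk; exists x.
  - by exists A; split=> //; apply: subset_trans XbX.
have [a [[Za aX] [ka Xk]]] := not_small_nonempty ns.
have [|A [AX nA sA hA]] := accum_homog _ (accum_cell aX Nk ka) Xk.
  by move=> x [/XN].
apply: ns; have AZ : A `<=` Z by move=> x /AX[/XNZ[]].
apply: small_sub (Zs A (~~ b) AZ nA sA hA) => a' [[Za' _] [_ Xk']].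
by split=> // x /AX; apply: Xk'.
Qed.

Lemma sparse_undecided Z X : sparse Z -> X `<=` N `&` Z -> undecided Z X Z.
Proof.
move=> Zs XNZ X' b X'X hX'.
have X'NZ : X' `<=` N `&` Z by apply: subset_trans XNZ.
have [A [AX' nA sA hA]] := heavy_homog b Zs X'NZ hX'.
have AZ : A `<=` Z by move=> x /AX'/X'NZ[].
apply: small_sub (Zs A b AZ nA sA hA) => a [Za X'a].
by split=> // x /AX'; apply: X'a.
Qed.
(** * Selecting the points: a Ramsey argument *)

Variable lt : T -> T -> Prop.

Definition separated (Z : nat -> set T) : Prop :=
  forall i j x y, (i < j)%N -> Z i x -> Z j y -> lt x y.

(** Stands for a homogeneous set of type omega_1 * n: the pieces need only be uncountable, as each
    is thinned to type omega_1 at the end. *)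
Definition chain (b : bool) (n : nat) (S : set T) : Prop :=
  exists A : nat -> set T,
    [/\ forall k, (k < n)%N -> A k `<=` S /\ ~ countable (A k),
        forall k l x y, (k < l < n)%N -> A k x -> A l y -> lt x y &
        forall k l x y, (k < n)%N -> (l < n)%N ->
          A k x -> A l y -> x <> y -> c x y = b].

Lemma chain0 b S : chain b 0 S.
Proof. by exists (fun=> set0); split=> // k l x y /andP[]. Qed.

Lemma sub_chain b n S S' : S `<=` S' -> chain b n S -> chain b n S'.
Proof.
move=> SS' [A [AS Alt Ac]]; exists A; split=> // k kn; have [Ak nA] := AS k kn.
by split=> //; apply: subset_trans SS'.
Qed.

Lemma chain_cons b n A S S' : A `<=` S -> S' `<=` S -> ~ countable A ->
  homog b A -> (forall x y, A x -> S' y -> lt x y /\ c x y = b) ->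
  chain b n S' -> chain b n.+1 S.
Proof.
move=> AS S'S nA hA AS' [B [BS Blt Bc]].
have BS' k x : (k < n)%N -> B k x -> S' x by move=> /BS[+ _] Bx; apply.
exists (fun k => if k is k'.+1 then B k' else A); split.
- move=> [_|k]; first by split.
  by rewrite ltnS => /BS[BkS' nB]; split=> //; apply: subset_trans S'S.
- move=> [|k] [|l] x y //; rewrite ?ltnS.
    by move=> ln Ax By; apply: (AS' x y _ _).1 => //; apply: BS' By.
  exact: Blt.
- move=> [|k] [|l] x y //; rewrite ?ltnS.
  + by move=> _ _; apply: hA.
  + by move=> _ ln Ax By _; apply: (AS' x y _ _).2 => //; apply: BS' By.
  + move=> kn _ Bx Ay _; rewrite cC.
    by apply: (AS' y x _ _).2 => //; apply: BS' Bx.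
  + exact: Bc.
Qed.

Variables (Z : nat -> set T) (n M : bool -> nat).
Hypothesis Zsep : separated Z.

Definition decr (m : bool -> nat) (b b' : bool) : nat := m b' - (b' == b).

(** Only the blocks listed in [s] must be large and sparse, so the remaining ones may be emptied. *)
Definition forces (m : bool -> nat) (k : nat) : Prop :=
  forall Y : nat -> set T, separated Y -> forall s, sorted ltn s -> (k <= size s)%N ->
  (forall i, i \in s -> ~ small (Y i) /\ sparse (Y i)) ->
  exists b, chain b (m b) (\bigcup_i Y i).

Hypothesis M_forces : forall b, forces (decr n b) (M b).

(** The inductive bound [M b] is applied to the common neighbourhoods of [A]; if the chain found has
    colour [b], prefixing [A] makes up for its missing piece. *)
Lemma decided_chain j A b s : A `<=` Z j -> ~ countable A -> homog b A ->
  path ltn j s -> (M b <= size s)%N ->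
  (forall i, i \in s -> ~ small (decided A (Z i) b) /\ sparse (Z i)) ->
  exists b', chain b' (n b') (\bigcup_i Z i).
Proof.
move=> AZ nA hA js Ms sP.
(* Blocks up to [j] are emptied, so that the chain found lies above [A]. *)
pose Y i := if (j < i)%N then decided A (Z i) b else set0.
have YZ i : Y i `<=` Z i by rewrite /Y; case: ifP => // _ a [].
have [| |b' ch] := @M_forces b Y _ s (path_sorted js) Ms.
- by move=> i i' x y ii' /YZ Zx /YZ; apply: Zsep ii' Zx.
- move=> i si; rewrite /Y.
  have -> : (j < i)%N by move/(order_path_min ltn_trans)/allP: js; apply.
  by have [? ?] := sP i si; split=> //; apply: sub_sparse (sP i si).2 => a [].
exists b'.
have UYZ : \bigcup_i Y i `<=` \bigcup_i Z i.
  by move=> x [i _ /YZ Zx]; exists i.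
move: ch; rewrite /decr; have [->|_] := eqVneq b' b; last first.
  by rewrite subn0; apply: sub_chain.
case: (n b) => [_|m]; first exact: chain0.
rewrite subSS subn0; apply: chain_cons UYZ nA hA _.
  by move=> x /AZ Zx; exists j.
move=> x y Ax [i _]; rewrite /Y; case: ifP => // ji [Zy cAy].
by split; [apply: Zsep ji (AZ _ Ax) Zy|apply: cAy].
Qed.

(** The blocks are treated one by one; both alternatives survive later shrinking of the set. *)
Lemma undecided_refine Y X (s : seq nat) : heavy Y X ->
  exists X', [/\ X' `<=` X, heavy Y X' &
  forall i, i \in s -> undecided Y X' (Z i) \/
    exists b, ~ small (decided X' (Z i) b)].
Proof.
move=> hX; elim: s => [|i s [X1 [X1X hX1 X1s]]]; first by exists X; split.
have [u|nu] := pselect (undecided Y X1 (Z i)).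
  exists X1; split=> // k; rewrite inE => /predU1P[->|/X1s//].
  by left.
have [X2 [b [X2X1 hX2 ns]]] : exists X2 b,
    [/\ X2 `<=` X1, heavy Y X2 & ~ small (decided X2 (Z i) b)].
  apply: contrapT => no; apply: nu => X2 b X2X1 hX2.
  by apply: contrapT => ns; apply: no; exists X2, b.
exists X2; split=> [|//|k]; first exact: subset_trans X1X.
rewrite inE => /predU1P[->|/X1s[u|[b' ns']]].
- by right; exists b.
- by left; apply: undecided_sub u.
- right; exists b' => s'; apply: ns'; apply: small_sub s' => a [Za X1a].
  by split=> // x /X2X1; apply: X1a.
Qed.

Lemma rows_chain b (o : seq nat) X al : uniq o ->
  (forall k, k \in o -> X k `<=` N `&` Z k /\ accum (al k) (X k)) ->
  (forall k l x, k \in o -> l \in o -> X k x -> c x (al l) = b) ->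
  chain b (size o) (\bigcup_i Z i).
Proof.
move=> ou oX Xal.
have [k ko x|k ko||A [AX AA]] := @uncountable_rows o b X al; last 1 first.
(* The blocks in [o] may come in any order, whereas a chain must be increasing. *)
- pose s := sort leq o.
  have so k : (k < size o)%N -> nth 0 s k \in o.
    by move=> ko; rewrite -(mem_sort leq) mem_nth // size_sort.
  have ss : sorted ltn s.
    by rewrite ltn_sorted_uniq_leq sort_uniq ou (sort_sorted leq_total).
  have AZ k : k \in o -> A k `<=` Z k.
    by move=> ko x /(AX k ko).1 /(oX k ko).1[].
  exists (fun k => A (nth 0 s k)); split.
  + move=> k /so ko; split; last exact: (AX _ ko).2.
    by move=> x /(AZ _ ko) Zx; exists (nth 0 s k).
  + move=> k l x y /andP[kl lo] Ax Ay; have ko := ltn_trans kl lo.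
    apply: Zsep (AZ _ (so _ ko) _ Ax) (AZ _ (so _ lo) _ Ay).
    by apply: (sorted_ltn_nth ltn_trans) => //; rewrite inE size_sort.
  + by move=> k l x y /so ko /so lo; apply: AA.
- by move=> /(oX k ko).1[].
- by have [_] := oX k ko.
- exact: Xal.
Qed.

(** [K] points are missing. One block gives the next point, fewer than [M b] blocks are dropped as
    decided in colour [b], and half of the rest is kept to make the colour with the new point
    uniform. *)
Fixpoint supply (K : nat) : nat :=
  if K is K'.+1 then (M true + M false + 2 * supply K').+1 else 0.

(* One step of the selection: the new point a must keep every set attached to
   an already selected point heavy there, and this excludes few points only. *)
Lemma choose_point (o : bool -> seq nat) X al j X1 :
  ~ small (Z j) -> sparse (Z j) -> X1 `<=` N `&` Z j -> heavy (Z j) X1 ->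
  (forall b k, k \in o b ->
    heavy_at (Z k) (al k) (X k) /\ undecided (Z k) (X k) (Z j)) ->
  exists a, [/\ Z j a, forall b, heavy_at (Z j) a (fiber X1 a b) &
    forall b k, k \in o b -> heavy_at (Z k) (al k) (fiber (X k) a b)].
Proof.
move=> nsZ spZ X1NZ hX1 oP.
pose bad1 b := [set a | Z j a /\
  (heavy_at (Z j) a X1 /\ ~ heavy_at (Z j) a (fiber X1 a b))].
pose bad2 b := \bigcup_(k in [set k | k \in o b])
  [set a | Z j a /\ ~ heavy_at (Z k) (al k) (fiber (X k) a b)].
have sbad1 b : small (bad1 b).
  by apply: heavy_at_self_fiber_almost; apply: sparse_undecided.
have sbad2 b : small (bad2 b).
  apply: small_bigcup => [|k /oP[kX ku]]; first exact/countable_small/countableP.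
  exact: heavy_at_fiber_almost.
have := not_smallD (heavy_heavy_at hX1) (small_setU
  (small_setU (sbad1 true) (sbad1 false)) (small_setU (sbad2 true) (sbad2 false))).
move=> /not_small_nonempty[a [[Za hXa] nbad]]; exists a; split=> // b.
  apply: contrapT => nh; apply: nbad; left.
  by case: b nh => nh; [left|right].
move=> k ko; apply: contrapT => nh; apply: nbad; right.
by case: b ko nh => ko nh; [left|right]; exists k.
Qed.

Lemma size_cover (p q q' : pred nat) s :
  {in s, forall i, [|| p i, q i | q' i]} ->
  (size s <= size (filter p s) + size (filter q s) + size (filter q' s))%N.
Proof.
elim: s => //= i s IHs cov; have := cov i (mem_head _ _).
have /IHs : {in s, forall i, [|| p i, q i | q' i]}.
  by move=> k ks; apply: cov; rewrite inE ks orbT.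
by case: (p i) (q i) (q' i) => -[] [] //=; lia.
Qed.

(* o b lists the blocks selected with colour b, al their points, and r the blocks
   still available. Later points are required to have colour b with X k for k in
   o b; for available blocks X k already has the colours attached to the selected
   points. *)
Definition selection (o : bool -> seq nat) (X : nat -> set T) (al : nat -> T)
    (r : seq nat) : Prop :=
  [/\ forall i, i \in r ->
        [/\ ~ small (Z i), sparse (Z i), X i `<=` N `&` Z i & heavy (Z i) (X i)],
      forall b k, k \in o b ->
        [/\ k \notin r, k \notin o (~~ b), X k `<=` N `&` Z k,
            heavy_at (Z k) (al k) (X k) &
            forall i, i \in r -> undecided (Z k) (X k) (Z i)],
      forall b, uniq (o b) &
      forall b k l x, l \in o b -> (k \in o b) || (k \in r) -> X k x ->
        c x (al l) = b].

Lemma selection_chain o X al r b : selection o X al r -> (n b <= size (o b))%N ->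
  exists b, chain b (n b) (\bigcup_i Z i).
Proof.
move=> [_ oP ou oX] nb; exists b.
have [|||A [AZ Alt Ac]] := @rows_chain b (o b) X al => //.
- by move=> k /oP[_ _ ? /heavy_at_accum].
- by move=> k l x ko lo; apply: oX => //; rewrite ko.
- exists A; split=> [k kn|k l x y /andP[kl ln]|k l x y kn ln].
  + exact: AZ (leq_trans kn nb).
  + by apply: Alt; rewrite kl (leq_trans ln nb).
  + by apply: Ac; [exact: leq_trans kn nb|exact: leq_trans ln nb].
Qed.

(** If a part of [X j] decides many later blocks in one colour, [decided_chain] concludes. Otherwise
    a point is selected in block [j] and at least [m] blocks remain available. *)
Lemma selection_step m o X al j r : selection o X al (j :: r) -> sorted ltn (j :: r) ->
  (M true + M false + 2 * m <= size r)%N ->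
  (exists b, chain b (n b) (\bigcup_i Z i)) \/
  exists b X' al' r',
  [/\ selection (fun b' => if b' == b then j :: o b' else o b') X' al' r',
    sorted ltn r' & (m <= size r')%N].
Proof.
move=> [rP oP ou oX] rs rm.
have [nsZj spZj XjNZ hXj] := rP j (mem_head _ _).
have rj i : i \in r -> i \in j :: r by rewrite inE orbC => ->.
have [X1 [X1X hX1 X1r]] := undecided_refine r hXj.
have X1NZ : X1 `<=` N `&` Z j by apply: subset_trans XjNZ.
pose dec b i := `[< ~ small (decided X1 (Z i) b) >].
have [[b Mb]|few] := pselect (exists b, M b <= size (filter (dec b) r))%N.
  left; have [A [AX1 nA sA hA]] := heavy_homog b spZj X1NZ hX1.
  have AZ : A `<=` Z j by move=> x /AX1/X1NZ[].
  apply: (decided_chain AZ nA hA _ Mb).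
    by apply: subseq_path (filter_subseq _ _) rs; apply: ltn_trans.
  move=> i; rewrite mem_filter => /andP[/asboolP ns /rj/rP[_ spZi _ _]].
  split=> // s; apply: ns; apply: small_sub s => a [Za X1a].
  by split=> // x /AX1; apply: X1a.
have few' b : (size (filter (dec b) r) < M b)%N.
  by rewrite ltnNge; apply/negP => Mb; apply: few; exists b.
right; pose st i := `[< undecided (Z j) X1 (Z i) >].
have size_st : (2 * m <= size (filter st r))%N.
  have /(@size_cover st (dec true) (dec false)) :
      {in r, forall i, [|| st i, dec true i | dec false i]}.
    move=> i /X1r[u|[b ns]]; first by rewrite /st (asboolT u).
    by case: b ns => ns; rewrite /dec (asboolT ns) ?orbT.
  move: (few' true) (few' false) rm; move: (size (filter st r)).
  by move: (size (filter _ r)) (size (filter _ r)) (size r); lia.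
have [|a [Zja haj hao]] := choose_point (o := o) (X := X) (al := al) nsZj spZj X1NZ hX1.
  by move=> b k /oP[_ _ _ hk uk]; split=> //; apply: uk; apply: mem_head.
have [b [r' [r'st r's r'm r'h]]] : exists b r', [/\ {subset r' <= filter st r},
    sorted ltn r', (m <= size r')%N &
    forall i, i \in r' -> heavy (Z i) (fiber (X i) a b)].
  (* Majority choice of the colour: where the fiber of colour [true] is not heavy, the other one
     is. *)
  pose h i := `[< heavy (Z i) (fiber (X i) a true) >].
  have sub p : {subset filter p (filter st r) <= filter st r}.
    by move=> i; rewrite mem_filter => /andP[].
  have srt p : sorted ltn (filter p (filter st r)).
    by do 2!apply: (sorted_filter ltn_trans); apply: path_sorted rs.
  have [hm|hm] := leqP m (size (filter h (filter st r))).
    exists true, (filter h (filter st r)); split=> // i.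
    by rewrite mem_filter => /andP[/asboolP].
  exists false, (filter (predC h) (filter st r)); split=> //.
    move: hm size_st; have := count_predC h (filter st r); rewrite -!size_filter.
    by move: (size (filter st r)) (size _) (size _); lia.
  move=> i; rewrite mem_filter /= => /andP[/asboolPn nh].
  rewrite mem_filter => /andP[_ /rj/rP[_ _ _ /(heavy_fiber a)[[] // hi]]].
(* Sets of available blocks and of points of colour [b] are cut to colour [b] with [a]; those of
   points of the other colour stay unchanged. *)
exists b, (fun k => if k == j then fiber X1 a b else
  if (k \in o b) || (k \in r') then fiber (X k) a b else X k),
  (fun k => if k == j then a else al k), r'; split=> //.
have jr : j \notin r.
  by apply/negP => /(allP (order_path_min ltn_trans rs)); rewrite ltnn.
have r'r i : i \in r' -> i \in r /\ i != j.
  move=> /r'st; rewrite mem_filter => /andP[_ ir]; split=> //.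
  by apply: contraNneq jr => <-.
have or k b' : k \in o b' -> k != j /\ k \notin r'.
  move=> /oP[]; rewrite inE negb_or => /andP[-> kr] _ _ _ _; split=> //.
  by apply: contra kr => /r'r[].
have fibS X' b' : fiber X' a b' `<=` X' by move=> x [].
have oN k : k \in o b -> k \notin o (~~ b) by move=> /oP[].
have oNb k b' : k \in o b' -> b' != b -> (k \in o b) = false.
  by move=> ko; case: b' b ko {r'h haj hao oN} => -[] // /oP[_ /negbTE].
split.
- move=> i ir'; have [ir ij] := r'r i ir'; rewrite (negbTE ij) ir' orbT.
  have [nsZi spZi XiNZ _] := rP i (rj i ir); split=> //; last exact: r'h.
  exact: subset_trans XiNZ.
- move=> b' k; case: (b' =P b) => [->|/eqP b'b]; last first.
    move=> ko; have [kj kr'] := or k b' ko.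
    rewrite (negbTE kj) (negbTE kr') (oNb _ _ ko b'b) /=.
    have [_ kN ? ? uk] := oP b' k ko.
    split=> //; last by move=> i /r'r[/rj/uk].
    by case: ifP => _ //; rewrite inE negb_or kj.
  rewrite inE => /predU1P[->|ko].
    rewrite eqxx; split=> //.
    + by apply: contra jr => /r'r[].
    + rewrite (_ : ~~ b == b = false); last by case: (b).
      by apply/negP => /or[]; rewrite eqxx.
    + exact: subset_trans X1NZ.
    + move=> i /r'st; rewrite mem_filter => /andP[/asboolP ui _].
      exact: undecided_sub ui.
  have [kj kr'] := or k b ko; rewrite (negbTE kj) ko /=.
  have [_ kN kNZ ? uk] := oP b k ko; split=> //.
  + by rewrite (_ : ~~ b == b = false) //; case: (b).
  + exact: subset_trans kNZ.
  + exact: hao.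
  + by move=> i /r'r[/rj/uk ui _]; apply: undecided_sub ui.
- move=> b'; case: eqP => // -> /=; rewrite ou andbT.
  by apply/negP => /or[]; rewrite eqxx.
- move=> b' k l x; case: (b' =P b) => [->|/eqP b'b]; last first.
    move=> lo kor; have [lj _] := or l b' lo; rewrite (negbTE lj).
    have [kj|kj] := eqVneq k j.
      by move=> [/X1X Xx _]; apply: (oX b' j l x lo) => //; rewrite mem_head orbT.
    have kor' : (k \in o b') || (k \in j :: r).
      by case/orP: kor => [->//|/r'r[/rj -> _]]; rewrite orbT.
    by case: ifP => [_ []|_] Xx; [move=> _|]; apply: (oX b' k l x lo).
  rewrite !inE => /predU1P[->|lo].
    rewrite eqxx; have [_ _ []//|kj /=] := eqVneq k j.
    by move=> -> [].
  have [lj _] := or l b lo; rewrite (negbTE lj).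
  have [kj _|kj /= kor] := eqVneq k j.
    by move=> [/X1X Xx _]; apply: (oX b j l x lo) => //; rewrite mem_head orbT.
  rewrite kor => -[Xx _]; apply: (oX b k l x lo) => //.
  by case/orP: kor => [->//|/r'r[/rj -> _]]; rewrite orbT.
Qed.

Lemma selection_supply K o X al r :
  (n true - size (o true) + (n false - size (o false)) <= K)%N ->
  (supply K <= size r)%N -> sorted ltn r -> selection o X al r ->
  exists b, chain b (n b) (\bigcup_i Z i).
Proof.
elim: K o X al r => [|K IHK] o X al r oK rK rs sel.
  by apply: (selection_chain (b := true) sel); lia.
have [/(selection_chain sel)//|nt] := leqP (n true) (size (o true)).
have [/(selection_chain sel)//|nf] := leqP (n false) (size (o false)).
case: r rK rs sel => // j r rK rs sel.
have [//|[b [X' [al' [r' [sel' rs' r'K]]]]]] := selection_step sel rs rK.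
apply: IHK sel' => //=.
by case: b => /=; lia.
Qed.

End Types.

(** * Well-ordered recursion and the closure of N *)

Lemma ordinal_ind (W : ordinal_type) (P : W -> Prop) :
  (forall x, (forall y, initial_segment x y -> P y) -> P x) -> forall x, P x.
Proof.
move=> IH x; apply: contrapT => nPx.
have [|z nPz zmin] := well_order_min (P := fun y => ~ P y) (ord_wo W).
  by exists x.
apply: nPz; apply: IH => y [yz nyz]; apply: contrapT => /zmin zy.
by apply: nyz; apply: (well_order_anti (ord_wo W)); rewrite yz zy.
Qed.

(** Recursion by a specification: each value is chosen classically, and [b0] fills the values not
    yet defined, which [P] cannot detect. *)
Lemma ordinal_rec (W : ordinal_type) (B : Type) (b0 : B)
    (P : W -> (W -> B) -> B -> Prop) :
  (forall x g g' b, (forall y, initial_segment x y -> g y = g' y) ->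
    P x g b -> P x g' b) ->
  (forall x g, exists b, P x g b) -> exists f : W -> B, forall x, P x f (f x).
Proof.
move=> Pext Pex.
have wf : well_founded (fun y x : W => initial_segment x y).
  by move=> x; elim/ordinal_ind: x => x IHx; constructor.
pose ext x (rec : forall y : W, initial_segment x y -> B) (y : W) : B :=
  if pselect (initial_segment x y) is left xy then rec y xy else b0.
pose f := Fix wf (fun=> B) (fun x rec => projT1 (cid (Pex x (ext x rec)))).
exists f => x; rewrite /f Fix_eq => [|y g g' gg']; last first.
  congr (projT1 (cid (Pex y (ext y _)))); apply: functional_extensionality_dep.
  by move=> z; apply/funext => yz.
case: cid => b /= ; apply: Pext => y xy.
by rewrite /ext; case: pselect.
Qed.

Lemma ord_le_or_lt (W : ordinal_type) (x y : W) :
  ord_le x y \/ initial_segment x y.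
Proof.
have [|xy] := boolP (ord_le x y); [by left|right; split].
  by have /orP[//|] := well_order_total (ord_wo W) y x; rewrite (negbTE xy).
by move=> yx; move: xy; rewrite yx (well_order_refl (ord_wo W)).
Qed.

Lemma ord_le_trans (W : ordinal_type) (x y z : W) :
  ord_le x y -> ord_le y z -> ord_le x z.
Proof.
move=> xy yz.
have [|t t3 tmin] := well_order_min (P := [set x; y; z]) (ord_wo W).
  by exists x; left; left.
have [tx ty tz] : [/\ ord_le t x, ord_le t y & ord_le t z].
  by split; apply: tmin; [left; left|left; right|right].
have anti := well_order_anti (ord_wo W).
case: t3 tx ty tz => [[]|] -> // tx ty tz.
  by have -> : x = y by apply: anti; rewrite xy.
have yE : y = z by apply: anti; rewrite yz.
by rewrite -yE.
Qed.

Lemma ord_lt_le_trans (W : ordinal_type) (x y z : W) :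
  initial_segment y x -> ord_le y z -> initial_segment z x.
Proof.
move=> [xy nxy] yz; split; first exact: ord_le_trans yz.
by move=> xz; apply: nxy; apply: (well_order_anti (ord_wo W)); rewrite xy xz.
Qed.

Section Closure.
Variables (T : Type) (c : T -> T -> bool).
Hypothesis cC : forall x y, c x y = c y x.
Variable W : ordinal_type.
Hypotheses (W_uncountable : ~ countable [set: W]) (W_small : small [set: W]).
Hypothesis W_segment : forall x : W, countable (initial_segment x).

(** Otherwise [W] would be a countable union of countable segments. *)
Lemma sequence_bounded (e : nat -> W) :
  exists w, forall n, initial_segment w (e n).
Proof.
apply: contrapT => no; apply: W_uncountable.
apply: (@sub_countable _ _ _ (\bigcup_n (initial_segment (e n) `|` [set e n]))).
  apply: subset_card_le => w _; apply: contrapT => nw; apply: no; exists w => n.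
  have [wen|//] := ord_le_or_lt w (e n).
  case: nw; exists n => //; have [->|] := pselect (w = e n); first by right.
  by left; split.
by apply: bigcup_countable => // n _; apply: countable_setU.
Qed.

Section Generated.
Variables (x0 : T) (h : key T -> nat -> T).

(** The closure of [x0] under the functions [h], ranked by [W] so that the size of each stage can be
    bounded by induction. *)
Inductive generated : W -> T -> Prop :=
| generated0 w : generated w x0
| generatedS w k j (e : nat -> W) : (forall n, initial_segment w (e n)) ->
    (forall n, generated (e n) (k.1 n)) -> generated w (h k j).

Lemma generated_small w : small (generated w).
Proof.
elim/ordinal_ind: w => w IHw.
pose U := \bigcup_(v in initial_segment w) generated v.
have sU : small U.
  by apply: small_bigcup => //; apply: countable_small.
pose V := \bigcup_(j : nat) [set h k j | k in keys U].
apply: (@small_sub _ _ ([set x0] `|` V)) => [x|].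
  rewrite /V /U {V sU U IHw}; case=> [v|v k j e ev ke]; first by left.
  by right; exists j => //; exists k => // n; exists (e n).
apply: small_setU; first exact/countable_small/finite_set_countable.
apply: small_bigcup => [|j _]; first exact/countable_small/countableP.
exact: small_image (small_seq_valued sU).
Qed.

End Generated.

(** [h] picks a witness in each nonempty cell trace. The ranks of the countably many elements in a
    key are bounded, so its witness appears at a later stage. *)
Lemma closed_exists (Z : nat -> set T) (x0 : T) :
  exists N : set T, [/\ small N, N x0 & forall j, closed_for c N (Z j)].
Proof.
have /choice[h hP] : forall p : key T * nat, exists y,
    Z p.2 `&` cell c p.1 !=set0 -> (Z p.2 `&` cell c p.1) y.
  move=> p; have [[y Zy]|no] := pselect (Z p.2 `&` cell c p.1 !=set0).
    by exists y.
  by exists x0.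
pose h' k j := h (k, j).
exists [set x | exists w, generated x0 h' w x]; split.
- apply: (@small_sub _ _ (\bigcup_w generated x0 h' w)) => [x [w]|].
    by exists w.
  by apply: small_bigcup => // w _; apply: generated_small.
- have [w _] : [set: W] !=set0.
    apply: contrapT => /set0P/negP/negPn/eqP W0; apply: W_uncountable.
    by rewrite W0; apply: countable0.
  by exists w; constructor.
- move=> j k /choice[e eP] /not_small_nonempty Zk.
  have [Zh kh] := hP (k, j) Zk; have [w we] := sequence_bounded e.
  exists (h' k j); do 2!split=> //.
  by exists w; apply: (generatedS _ we).
Qed.

(** Induction on the total length wanted, which provides the bounds [M b]; the selection starts with
    no points and the traces of [N]. *)
Lemma forces_exists (lt : T -> T -> Prop) (n : bool -> nat) :
  exists m, forces c lt n m.
Proof.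
have [k] := ubnP (n true + n false); elim: k n => // k IHk n nk.
have [[b nb]|npos] := pselect (exists b, n b = 0).
  by exists 0 => Y _ s _ _ _; exists b; rewrite nb; apply: chain0.
have n_gt0 b : (0 < n b)%N.
  by rewrite lt0n; apply/eqP => nb; apply: npos; exists b.
have /choice[M MP] : forall b, exists m, forces c lt (decr n b) m.
  move=> b; apply: IHk; rewrite /decr.
  by have := n_gt0 true; have := n_gt0 false; case: b => /=; lia.
exists (supply M (n true + n false)) => Z Zsep s ss sM sP.
have [i si] : exists i, i \in s.
  case: s sM {ss sP} => [|i s _]; last by exists i; apply: mem_head.
  by have := n_gt0 true; case: (n true).
have [x0 _] := not_small_nonempty (sP i si).1.
have [N [sN Nx0 Ncl]] := closed_exists Z x0.
have N0 : N !=set0 by exists x0.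
apply: (@selection_supply T c N cC sN N0 lt Z n M Zsep MP _ (fun=> [::])
  (fun j => N `&` Z j) (fun=> x0) s (leqnn _)) => //=.
  by rewrite !subn0.
split=> // j js; have [nsZ spZ] := sP j js; split=> //.
exact: heavy_closed.
Qed.

End Closure.

(** * Consecutive large blocks in omega_3 *)

Lemma card_le_inj (T U : Type) (A : set T) (u0 : U) : A #<= [set: U] ->
  exists f : T -> U, {in A &, injective f}.
Proof.
move=> /card_leP[f].
exists (fun t =>
  if pselect (A t) is left At then val (f (SigSub (mem_set At))) else u0).
move=> x y /set_mem Ax /set_mem Ay.
case: pselect => // Ax'; case: pselect => // Ay' /val_inj fxy.
by have [] := inj (mem_set I) (mem_set I) fxy.
Qed.

Lemma inj_card_leT (T U : Type) (f : T -> U) : injective f -> [set: T] #<= [set: U].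
Proof.
move=> finj; apply/card_leP/injfunPex.
exists (fun s : [set: T] => SigSub (mem_set (I : [set: U] (f (val s))))) => //.
by move=> s t _ _ [] /finj /val_inj.
Qed.

Lemma increasing_mono (a b : ordinal_type) (f : a -> b) :
  (forall p q, initial_segment q p -> initial_segment (f q) (f p)) ->
  injective f /\ {mono f : x y / ord_le x y}.
Proof.
move=> finc; have [wa wb] := (ord_wo a, ord_wo b).
have f_le p q : ord_le p q -> ord_le (f p) (f q).
  move=> pq; have [->|npq] := pselect (p = q); first exact: well_order_refl.
  by have [] := finc p q (conj pq npq).
split=> [p q fpq|p q].
  have [pq|[qp nqp]] := ord_le_or_lt p q.
    have [//|npq] := pselect (p = q).
    by have [_ []] := finc p q (conj pq npq).
  by have [_ []] := finc q p (conj qp nqp).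
apply/idP/idP => [fpq|]; last exact: f_le.
have [//|qp] := ord_le_or_lt p q.
have [fqp nfqp] := finc q p qp.
by case: nfqp; apply: (well_order_anti wb); rewrite fqp fpq.
Qed.

Lemma uncountable_embed (W T : ordinal_type) (A : set T) :
  (forall x : W, countable (initial_segment x)) -> ~ countable A ->
  exists f : W -> T, (forall x, A (f x)) /\
    forall x y, initial_segment x y -> initial_segment (f x) (f y).
Proof.
move=> W_segment nA.
have [A' [A'A nA' A'seg]] : exists A' : set T, [/\ A' `<=` A, ~ countable A' &
    forall a, A' a -> countable [set b | A' b /\ ord_le b a]].
  have [all|/existsNP[t nt]] :=
      pselect (forall t, countable [set b | A b /\ ord_le b t]).
    by exists A; split.
  (* Below the least [u] with uncountably many elements of [A] up to it, every element has only
     countably many. *)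
  have [|u nu umin] := well_order_min
      (P := fun t => ~ countable [set b | A b /\ ord_le b t]) (ord_wo T).
    by exists t.
  exists [set b | A b /\ initial_segment u b]; split=> [a []//|cu|a [Aa [au nau]]].
    apply: nu; have : countable ([set b | A b /\ initial_segment u b] `|` [set u]).
      exact: countable_setU.
    apply: sub_countable; apply: subset_card_le => b [Ab bu].
    by have [->|nbu] := pselect (b = u); [right|left].
  have : countable [set b | A b /\ ord_le b a].
    apply: contrapT => /umin ua; apply: nau.
    by apply: (well_order_anti (ord_wo T)); rewrite au ua.
  by apply: sub_countable; apply: subset_card_le => b [[]].
have [t0 _] : A' !=set0.
  apply: contrapT => /set0P/negP/negPn/eqP A'0; apply: nA'.
  by rewrite A'0; apply: countable0.
(* The premise [A' (g y)] keeps the condition satisfiable when [g] takes values outside [A']. *)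
have [||f fP] := @ordinal_rec W T t0 (fun x g b => A' b /\
    forall y, initial_segment x y -> A' (g y) -> initial_segment b (g y)).
- move=> x g g' b gg' [A'b gb]; split=> // y xy; rewrite -(gg' y xy).
  exact: gb.
- move=> x g; apply: contrapT => no; apply: nA'.
  have : countable (\bigcup_(y in [set y | initial_segment x y /\ A' (g y)])
      [set b | A' b /\ ord_le b (g y)]).
    apply: bigcup_countable => [|y [_]]; last exact: A'seg.
    by apply: sub_countable (W_segment x); apply: subset_card_le => y [].
  apply: sub_countable; apply: subset_card_le => b A'b.
  apply: contrapT => nb; apply: no; exists b; split=> // y xy A'gy.
  have [bg|//] := ord_le_or_lt b (g y).
  by case: nb; exists y.
exists f; split=> [x|x y xy]; first by apply: A'A; case: (fP x).
by have [_] := fP x; apply=> //; case: (fP y).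
Qed.

Definition olt (T : ordinal_type) (x y : T) : Prop := initial_segment y x.

(** Failure of sparseness yields a homogeneous piece [A] with a large common neighbourhood; the part
    [D] of it above [A] is still large, and the induction continues there with a smaller target. *)
Lemma sparse_or_chain (T : ordinal_type) (c : T -> T -> bool) (n : bool -> nat)
    (Z : set T) : (forall x y, c x y = c y x) -> ~ small Z ->
  (forall x, Z x -> small [set y | Z y /\ ord_le y x]) ->
  (exists Z', [/\ Z' `<=` Z, ~ small Z' & sparse c Z']) \/
  exists b, chain c (@olt T) b (n b) Z.
Proof.
move=> cC; have [k] := ubnP (n true + n false).
elim: k n Z => // k IHk n Z nk nsZ Zseg.
have [[b nb]|npos] := pselect (exists b, n b = 0).
  by right; exists b; rewrite nb; apply: chain0.
have n_gt0 b : (0 < n b)%N.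
  by rewrite lt0n; apply/eqP => nb; apply: npos; exists b.
have [Zs|nZs] := pselect (sparse c Z); first by left; exists Z; split.
have [A [b [AZ nA sA hA nD]]] : exists A b, [/\ A `<=` Z, ~ countable A, small A,
    homog c b A & ~ small (decided c A Z b)].
  apply: contrapT => no; apply: nZs => A b AZ nA sA hA.
  by apply: contrapT => nD; apply: no; exists A, b; split.
pose D := decided c A Z b `\` \bigcup_(x in A) [set y | Z y /\ ord_le y x].
have nsD : ~ small D.
  by apply: not_smallD => //; apply: small_bigcup => // x /AZ; apply: Zseg.
have DZ : D `<=` Z by move=> a [[]].
have AD x y : A x -> D y -> olt x y /\ c x y = b.
  move=> Ax [[Zy Ay] ny]; split; last exact: Ay.
  have [yx|//] := ord_le_or_lt y x.
  by case: ny; exists x.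
have [||[Z' [Z'D nsZ' spZ']]|[b' ch]] := IHk (decr n b) D _ nsD _.
- have := n_gt0 true; have := n_gt0 false.
  by rewrite /decr; case: (b) => /=; lia.
- move=> x /DZ /Zseg; apply: small_sub => y [/DZ].
  by split.
- by left; exists Z'; split=> //; apply: subset_trans DZ.
right; exists b'; move: ch; rewrite /decr.
have [->|_] := eqVneq b' b; last by rewrite subn0; apply: sub_chain.
case: (n b) => [_|m]; first exact: chain0.
by rewrite subSS subn0; apply: (chain_cons cC AZ DZ nA hA AD).
Qed.

(** * Cutting omega_3 into blocks under CH *)

Section CH.
Hypothesis ch : continuum_hypothesis.

Lemma small_omega1 (T : Type) (A : set T) : A #<= [set: omega 1] -> small A.
Proof. by move/card_le_trans; apply; move: ch => /card_eqPle[]. Qed.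

Lemma omega2_large : ~ small [set: omega 2].
Proof.
move=> s2; have [/negP + _] := omegaS 1; apply.
by apply: card_le_trans s2 _; move: ch => /card_eqPle[].
Qed.

Lemma omega2_segment (x : omega 2) : small (initial_segment x).
Proof. by apply: small_omega1; have [_] := omegaS 1; apply. Qed.

(* Fresh pairs of values are chosen by recursion. *)
Lemma omega2_double : exists G : bool -> omega 2 -> omega 2,
  forall b b' x x', G b x = G b' x' -> b = b' /\ x = x'.
Proof.
have [u0 _] := not_small_nonempty omega2_large.
have [||g gP] := @ordinal_rec (omega 2) (omega 2 * omega 2) (u0, u0)
    (fun x g p => p.1 <> p.2 /\ forall y, initial_segment x y ->
      [/\ p.1 <> (g y).1, p.1 <> (g y).2, p.2 <> (g y).1 & p.2 <> (g y).2]).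
- move=> x g g' p gg' [np pg]; split=> // y xy; rewrite -(gg' y xy).
  exact: pg.
- move=> x g; pose S := (fun y => (g y).1) @` initial_segment x `|`
    (fun y => (g y).2) @` initial_segment x.
  have sS : small S by apply: small_setU; apply/small_image/omega2_segment.
  have [p1 [_ np1]] := not_small_nonempty (not_smallD omega2_large sS).
  have s1 : small [set p1] by exact/countable_small.
  have [p2 [_ np2]] := not_small_nonempty (not_smallD omega2_large (small_setU sS s1)).
  exists (p1, p2); split=> [/= E|y xy]; first by apply: np2; right.
  split=> /= E; [apply: np1; left|apply: np1; right|apply: np2; left; left|
    apply: np2; left; right]; by exists y.
exists (fun b x => if b then (g x).1 else (g x).2) => b b' x x' E.
have [xx'|nxx'] := pselect (x = x').
  split=> //; subst x'; have [ne _] := gP x.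
  by case: b b' E => -[] // /esym.
have [lt|lt] : initial_segment x x' \/ initial_segment x' x.
  have [xx'|] := ord_le_or_lt x x'; [by right; split|by left].
- by have [_ /(_ x' lt)[]] := gP x; case: b b' E => -[].
- by have [_ /(_ x lt)[]] := gP x'; case: b b' E => -[] /esym.
Qed.

Definition block (x y : omega 3) : set (omega 3) :=
  [set z | ord_le x z /\ initial_segment y z].

(* Otherwise the elements above x inject into omega_2, by choosing fresh values
   recursively, and so does omega_3 = omega_2 + omega_2. *)
Lemma large_block (x : omega 3) : exists y, ~ small (block x y).
Proof.
apply: contrapT => no.
have sblock y : small (block x y) by apply: contrapT => ns; apply: no; exists y.
have [u0 _] := not_small_nonempty omega2_large.
(* Each value of [F] avoids the earlier ones from [x] on, so [F] is injective there. *)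
have [||F FP] := @ordinal_rec (omega 3) (omega 2) u0
    (fun z g b => forall w, block x z w -> b <> g w).
- by move=> z g g' b gg' gb w xzw; rewrite -gg'; [exact: gb|case: xzw].
- move=> z g; have := not_smallD omega2_large (small_image g (sblock z)).
  move=> /not_small_nonempty[b [_ nb]]; exists b => w xzw E.
  by apply: nb; exists w.
have [G Ginj] := omega2_double.
have [/negP nle seg] := omegaS 2; apply: nle.
have [s sinj] := card_le_inj u0 (seg x).
(* The segment below [x] is injected by [s], the rest by [F]; the tag in [G] keeps the images
   apart. *)
pose lo z := `[< initial_segment x z >].
apply: (@inj_card_leT _ _ (fun z => G (lo z) (if lo z then s z else F z))).
move=> z z' /Ginj[E]; rewrite -E; have [/asboolP xz|nxz] := boolP (lo z).
  have /asboolP xz' : lo z' by rewrite -E; apply/asboolP.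
  by move=> /sinj; apply; apply/mem_set.
have hi w : ~~ lo w -> ord_le x w.
  by move=> /asboolPn nw; have [//|] := ord_le_or_lt x w.
have xz := hi z nxz; have xz' : ord_le x z' by apply: hi; rewrite -E.
move=> FE; have [zz'|z'z] := ord_le_or_lt z z'.
  have [//|ne] := pselect (z = z').
  by case: (FP z' z); [split|].
by case: (FP z z'); [split|].
Qed.

(** The least end point giving a large block makes all its proper initial segments small. *)
Lemma next_block (x : omega 3) : exists y, ~ small (block x y) /\
  forall z, block x y z -> small [set w | block x y w /\ ord_le w z].
Proof.
have [|y ny ymin] := well_order_min
    (P := fun y => ~ small (block x y)) (ord_wo (omega 3)).
  exact: large_block.
exists y; split=> // z [xz [zy nzy]].
have sz : small (block x z).
  apply: contrapT => /ymin yz; apply: nzy.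
  by apply: (well_order_anti (ord_wo (omega 3))); rewrite zy yz.
have s1 : small [set z] by exact/countable_small.
apply: small_sub (small_setU sz s1) => w [[xw _] wz].
by have [->|nwz] := pselect (w = z); [right|left].
Qed.

Lemma omega3_chain (c : omega 3 -> omega 3 -> bool) (n : nat) :
  (forall x y, c x y = c y x) ->
  exists b, chain c (@olt (omega 3)) b n [set: omega 3].
Proof.
move=> cC; apply: contrapT => no.
have /choice[nxt nxtP] := next_block.
have [x0 _] : [set: omega 3] !=set0.
  apply: contrapT => /set0P/negP/negPn/eqP W0; have [/negP + _] := omegaS 2.
  by apply; rewrite W0; apply: card_ge0.
pose p k := iter k nxt x0; pose Z k := block (p k) (p k.+1).
have pS k : ord_le (p k) (p k.+1).
  have [/not_small_nonempty[z [xz [zy _]]] _] := nxtP (p k).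
  exact: ord_le_trans zy.
have p_le k l : (k <= l)%N -> ord_le (p k) (p l).
  move=> /subnK <-; elim: (l - k)%N => [|d IHd].
    exact: well_order_refl (ord_wo (omega 3)) _.
  exact: ord_le_trans IHd (pS _).
have /choice[Y YP] : forall k, exists Z', [/\ Z' `<=` Z k, ~ small Z' & sparse c Z'].
  move=> k; have [nsZ Zseg] := nxtP (p k).
  have [//|[b ch']] := sparse_or_chain (fun=> n) cC nsZ Zseg.
  by case: no; exists b; apply: sub_chain ch'.
(* [omega 1] ranks the closure stages: it is uncountable and small, with countable segments. *)
have [/negP W_unc W_seg] := omegaS 0.
have [m mP] := forces_exists cC W_unc (small_omega1 (card_lexx _)) W_seg
  (@olt (omega 3)) (fun=> n).
have Ysep : separated (@olt (omega 3)) Y.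
  move=> i j x y ij Yx Yy; have [YZi _ _] := YP i; have [YZj _ _] := YP j.
  have [_ xi] := YZi x Yx; have [jy _] := YZj y Yy.
  exact: ord_lt_le_trans xi (ord_le_trans (p_le _ _ ij) jy).
have [|i _|b ch'] := mP Y Ysep (iota 0 m) (iota_ltn_sorted 0 m).
- by rewrite size_iota.
- by have [] := YP i.
- by apply: no; exists b; apply: sub_chain ch'.
Qed.

End CH.

(** * From chains to the partition relation *)

Lemma chain_order_type (T : ordinal_type) (c : T -> T -> bool) b n :
  chain c (@olt T) b n [set: T] ->
  exists A : set T, has_order_type A (ord_mul (omega 1) (ord_fin n)) /\
    forall x y, A x -> A y -> x <> y -> c x y = b.
Proof.
move=> [A [AP Alt Ac]].
have [_ W_seg] := omegaS 0.
(* Each piece contains an increasing copy of omega_1; the order between pieces makes these copies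
   consecutive. *)
have /choice[F FP] : forall k : 'I_n, exists f : omega 1 -> T,
    (forall x, A k (f x)) /\
    forall x y, initial_segment x y -> initial_segment (f x) (f y).
  by move=> k; apply: uncountable_embed => //; case: (AP k (ltn_ord k)).
pose f (p : ord_mul (omega 1) (ord_fin n)) : T := F p.1 p.2.
have finc p q : initial_segment q p -> initial_segment (f q) (f p).
  case: p q => [i x] [j y] [/andP[/= ij /implyP xy] ne].
  have [ji|ij'] := leqP j i; last first.
    apply: (Alt i j); first by rewrite ij' ltn_ord.
      exact: (FP i).1.
    exact: (FP j).1.
  have E : i = j by apply/val_inj/eqP; rewrite eqn_leq ij ji.
  subst j; apply: (FP i).2; split; first exact: xy.
  by move=> /= E; apply: ne; rewrite E.
have [finj fmono] := increasing_mono finc.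
exists (range f); split.
  exists f => //; split=> [p _|p q _ _ /finj//|//].
  by exists p.
move=> _ _ [p _ <-] [q _ <-] ne.
by apply: (Ac p.1 q.1) => //; [apply: (FP p.1).1|apply: (FP q.1).1].
Qed.

Theorem mainTheorem6 : continuum_hypothesis ->
  forall n : nat, arrow (omega 3) (ord_mul (omega 1) (ord_fin n)).
Proof.
move=> ch n c.
have dP (x y : omega 3) : x <> y -> doubletons [set: omega 3] [set x; y].
  by move=> xy; exists x, y; split.
(* The colouring of doubletons becomes a symmetric function of two points, with [false] as default
   on the diagonal. *)
pose col (x y : omega 3) : bool :=
  if pselect (x <> y) is left xy then c (SigSub (mem_set (dP x y xy))) else false.
have colE (s : doubletons [set: omega 3]) x y : x <> y -> val s = [set x; y] ->
    c s = col x y.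
  by move=> xy sE; rewrite /col; case: pselect => // xy'; congr c; apply: val_inj.
have colC x y : col x y = col y x.
  have [<-//|xy] := pselect (x = y).
  rewrite {1}/col; case: pselect => // xy'; apply: colE; first exact: nesym.
  by rewrite /= setUC.
have [b /chain_order_type[A [Ao Ac]]] := omega3_chain ch n colC.
exists A; split=> //; exists b => s [x [y [Ax Ay xy sE]]].
by rewrite (colE s x y xy sE); apply: Ac.
Qed.
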